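(* Assume $R_0$ is trace class, and assume uniform trace leakage: there exists $\alpha\in(0,m]$ such that $s^{(\mathrm{tr})}_w\ge\alpha\,\mathrm{tr}(R_w)$ for every finite word $w\in\{1,\dots,m\}^*$. Put $T_n(\omega):=\mathrm{tr}(R_n(\omega))$ for $n\ge0$ and $c:=1-\alpha/m\in[0,1)$. Then: (1) For every $n\ge0$, $\mathbb{E}_{\nu_{\mathrm{tr}}}[T_n]\le c^nT_0$. (2) $T_n(\omega)\to0$ for $\nu_{\mathrm{tr}}$-almost every $\omega$. In particular, $\mathrm{tr}(R_\infty(\omega))=0$ for $\nu_{\mathrm{tr}}$-almost every $\omega$, and therefore $R_\infty(\omega)=0$ for $\nu_{\mathrm{tr}}$-almost every $\omega$.
   Context: $H$ is a complex Hilbert space and $B(H)_+$ is the set of bounded positive operators on $H$. Fix $m\ge1$, $R_0\in B(H)_+$ and contractions $C_1,\dots,C_m\in B(H)$. For finite words $w$ over $\{1,\dots,m\}$ (including the empty word $\emptyset$) define $R_\emptyset:=R_0$, $R_{wj}:=R_w^{1/2}(I-C_j^*C_j)R_w^{1/2}$, and $D_{w,j}:=R_w-R_{wj}=R_w^{1/2}C_j^*C_jR_w^{1/2}$. Path space: $\mathcal{A}:=\{0,1,\dots,m\}$, $\Omega:=\mathcal{A}^{\mathbb{N}}$ with the product topology and Borel $\sigma$-algebra; for a finite word $u$ over $\mathcal{A}$, $[u]$ is the cylinder of sequences with prefix $u$. If a finite word $u$ over $\mathcal{A}$ contains a $0$, set $R_u:=R_v$ with $v$ the prefix of $u$ before its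 first $0$. For a finite word $u$ and $a\in\mathcal{A}$, $D_{u,a}:=R_u^{1/2}C_a^*C_aR_u^{1/2}$ if $a\neq0$ and $u$ contains no $0$, and $D_{u,a}:=0$ otherwise. For $\omega\in\Omega$ let $\omega|n=\omega_1\cdots\omega_n$ ($\omega|0=\emptyset$), $R_n(\omega):=R_{\omega|n}$ ($n\ge0$), $D_n(\omega):=D_{\omega|n-1,\,\omega_n}$ ($n\ge1$). The sequence $R_n(\omega)$ is decreasing and $R_\infty(\omega)\in B(H)_+$ denotes its strong operator limit. Trace-biased measure $\nu_{\mathrm{tr}}$ (for $R_0$ trace class, in which case all $R_w$, $D_{w,j}$ are trace class): for $w\in\{1,\dots,m\}^*$ let $e^{(\mathrm{tr})}_{w,j}:=\mathrm{tr}(D_{w,j})$ and $s^{(\mathrm{tr})}_w:=\sum_{j=1}^me^{(\mathrm{tr})}_{w,j}$. If $s^{(\mathrm{tr})}_w>0$ put $p^{(\mathrm{tr})}_{w,0}:=0$, $p^{(\mathrm{tr})}_{w,j}:=e^{(\mathrm{tr})}_{w,j}/s^{(\mathrm{tr})}_w$ for $1\le j\le m$; if $s^{(\mathrm{tr})}_w=0$ put $p^{(\mathrm{tr})}_{w,0}:=1$, $p^{(\mathrm{tr})}_{w,j}:=0$ for $1\le j\le m$. If a finite word $u$ contains $0$, put $p^{(\mathrm{tr})}_{u,0}:=1$, $p^{(\mathrm{tr})}_{u,j}:=0$ for $1\le j\le m$. Then $\nu_{\mathrm{tr}}$ is the unique Borel probability measure on $\Omega$ with $\nu_{\mathrm{tr}}([\emptyset])=1$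 and $\nu_{\mathrm{tr}}([ua])=\nu_{\mathrm{tr}}([u])\,p^{(\mathrm{tr})}_{u,a}$ for all finite words $u$ over $\mathcal{A}$ and $a\in\mathcal{A}$ (Kolmogorov extension). *)

(* Defs.v *)
From HB Require Import structures.
From mathcomp Require Import all_boot all_order all_algebra.
From mathcomp Require Import complex.
From mathcomp Require Import all_classical all_reals all_analysis.

Set Implicit Arguments.
Unset Strict Implicit.
Unset Printing Implicit Defensive.

Import Order.TTheory GRing.Theory Num.Theory.
Import numFieldNormedType.Exports.

Local Open Scope classical_set_scope.
Local Open Scope ring_scope.

(** A complex Hilbert space is a complete normed module [H] over [R[i]] with an
    inner product [ip] (linear in its first argument) inducing the norm.
    Operators are plain functions [H -> H]; boundedness, positivity, etc. are
    predicates on them. *)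
Section operators.
Context {R : realType} {H : completeNormedModType R[i]}.
Context (ip : {dot H for (@Num.conj R[i])}).

Definition induces_norm := forall x : H, ip x x = `|x| ^+ 2.

Definition bounded_op (T : H -> H) : Prop :=
  linear T /\ bounded_near T (nbhs (0 : H)).

(* The order of [R[i]] makes [0 <= z] mean that [z] is real and nonnegative. *)
Definition positive_op (T : H -> H) : Prop :=
  bounded_op T /\ forall x, 0 <= ip (T x) x.

Definition contraction_op (T : H -> H) : Prop :=
  bounded_op T /\ forall x, `|T x| <= `|x|.

(* The adjoint of a bounded operator and the positive square root of a positive
   operator exist and are unique, so that [get] returns them. *)
Definition adjoint (T : H -> H) : H -> H :=
  get [set S | bounded_op S /\ forall x y, ip (T x) y = ip x (S y)].

Definition op_sqrt (T : H -> H) : H -> H :=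
  get [set S | positive_op S /\ S \o S = T].

Definition op_abs (T : H -> H) : H -> H := op_sqrt (adjoint T \o T).

Definition orthonormal_basis (E : set H) : Prop :=
  (forall e f, E e -> E f -> ip e f = (e == f)%:R) /\
  (forall x, (forall e, E e -> ip x e = 0) -> x = 0).

(* The trace of a positive operator, in [0, +oo]; it does not depend on the
   orthonormal basis, of which one is selected here.  The basis may be
   uncountable: [H] need not be separable. *)
Definition trace (T : H -> H) : \bar R :=
  \esum_(e in get orthonormal_basis) (complex.Re (ip (T e) e))%:E.

Definition trace_class (T : H -> H) : Prop :=
  bounded_op T /\ (trace (op_abs T) < +oo)%E.

Definition strong_lim (T : nat -> H -> H) : H -> H :=
  fun x => lim (T n x @[n --> \oo]).

End operators.

(** Words over {1, ..., m} are represented by [seq 'I_m].  The alphabet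
    {0, 1, ..., m} is ['I_m.+1], where [ord0] is the letter 0 and
    [lift ord0 j] is the letter of {1, ..., m} represented by [j : 'I_m]. *)
Section residuals.
Context {R : realType} {H : completeNormedModType R[i]}.
Context (ip : {dot H for (@Num.conj R[i])}).
Context {m : nat} (R0 : H -> H) (C : 'I_m -> H -> H).

Definition residual_step (T : H -> H) (j : 'I_m) : H -> H :=
  op_sqrt ip T \o (idfun \- (adjoint ip (C j) \o C j)) \o op_sqrt ip T.

(* The defining recursion is on the last letter:
   [residual (rcons w j) = residual_step (residual w) j]. *)
Definition residual (w : seq 'I_m) : H -> H := foldl residual_step R0 w.

Definition dissipated (w : seq 'I_m) (j : 'I_m) : H -> H :=
  residual w \- residual (rcons w j).

Definition trace_loss (w : seq 'I_m) (j : 'I_m) : \bar R :=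
  trace ip (dissipated w j).

Definition trace_loss_sum (w : seq 'I_m) : \bar R :=
  (\sum_(j < m) trace_loss w j)%E.

(* The letters before the first 0 (all of them if there is none). *)
Definition live_prefix (u : seq 'I_m.+1) : seq 'I_m :=
  pmap (unlift ord0) (take (index ord0 u) u).

Definition residual0 (u : seq 'I_m.+1) : H -> H := residual (live_prefix u).

(* The losses are finite when [R0] is trace class, hence the use of [fine]. *)
Definition trace_prob (u : seq 'I_m.+1) (a : 'I_m.+1) : R :=
  let w := live_prefix u in
  let s := trace_loss_sum w in
  if (ord0 \notin u) && (0 < s)%E then
    if unlift ord0 a is Some j then fine (trace_loss w j) / fine s else 0
  else (a == ord0)%:R.

End residuals.

(** The path space, with the product topology and its Borel sigma-algebra. *)
Definition path_space (m : nat) : Type :=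
  prod_topology (fun _ : nat => discrete_topology 'I_m.+1).

HB.instance Definition _ m := Topological.on (path_space m).
HB.instance Definition _ m := isPointed.Build (path_space m) (fun=> ord0).

Definition borel_path_space (m : nat) :=
  g_sigma_algebraType (@open (path_space m)).

(* The letters of a path are indexed from 0: [path_prefix n omega], usually
   written [omega|n], is [:: omega 0; ...; omega n.-1]. *)
Definition path_prefix (m n : nat) (omega : path_space m) : seq 'I_m.+1 :=
  mkseq omega n.

Definition cylinder (m : nat) (u : seq 'I_m.+1) : set (path_space m) :=
  [set omega | path_prefix (size u) omega = u].

Section path_processes.
Context {R : realType} {H : completeNormedModType R[i]}.
Context (ip : {dot H for (@Num.conj R[i])}).
Context {m : nat} (R0 : H -> H) (C : 'I_m -> H -> H).

Definition trace_biased (nu : probability (borel_path_space m) R) : Prop :=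
  nu (cylinder [::]) = 1%E /\
  forall (u : seq 'I_m.+1) (a : 'I_m.+1),
    nu (cylinder (rcons u a)) =
      (nu (cylinder u) * (trace_prob ip R0 C u a)%:E)%E.

Definition residual_path (n : nat) (omega : path_space m) : H -> H :=
  residual0 ip R0 C (path_prefix n omega).

Definition residual_limit (omega : path_space m) : H -> H :=
  strong_lim (fun n => residual_path n omega).

End path_processes.

(* Main.v *)
(* Let [t w] be the trace of [R_w].  Since [R_w = R_wj + D_wj] with both terms
   positive, [t] loses [e_j = tr D_wj] when the letter [j] is read, and the letters
   are drawn proportionally to these losses.  With [s = \sum_j e_j], the mean of
   [t] after one step is thus [t w - \sum_j e_j ^ 2 / s <= t w - s / m], by
   Cauchy-Schwarz, and leakage gives the factor [1 - alpha / m]; the letter 0 only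
   occurs where [t] vanishes.  As [t] decreases along paths, its limit has
   expectation 0, hence is 0 almost surely.  Along such a path the strong limit
   [L] of the decreasing positive operators [R_n] satisfies [<L e, e> = 0] for all
   [e] in an orthonormal basis, so [L e = 0] and [L = 0].

   The choice operators in the definitions are justified by constructing adjoints
   (a minimisation proof of Riesz's theorem), orthonormal bases (Zorn's lemma) and
   the unique positive square root.  Its existence and its uniqueness both
   rest on the positivity of a product of commuting positive operators. *)
Require Import Defs.
From HB Require Import structures.
From mathcomp Require Import all_boot all_order all_algebra.
From mathcomp Require Import complex ring lra.
From mathcomp Require Import all_classical all_reals all_analysis.
From mathcomp Require Import measurable_realfun.

Set Implicit Arguments.
Unset Strict Implicit.
Unset Printing Implicit Defensive.

Import Order.TTheory GRing.Theory Num.Theory.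
Import numFieldNormedType.Exports.

Local Open Scope classical_set_scope.
Local Open Scope ring_scope.

(** * Positive operators through the real inner product *)

(** The quadratic is evaluated at its minimiser [- b / c]. Applied in the scalar [t], this yields
    both Cauchy-Schwarz and the optimality condition in [riesz_real]. *)
Lemma square_le_discriminant (R : realFieldType) (a b c : R) : 0 <= c ->
  (forall t, 0 <= a + 2 * t * b + t ^+ 2 * c) -> b ^+ 2 <= a * c.
Proof.
move=> c0 h; have [c_eq0|c_neq0] := eqVneq c 0.
  rewrite c_eq0 mulr0; have [->|b_neq0] := eqVneq b 0; first by rewrite expr0n.
  (* With [c = 0] the polynomial is affine, and at this [t] it takes the value [-1]. *)
  have := h (- (a + 1) / (2 * b)); rewrite c_eq0 mulr0 addr0.
  have -> : 2 * (- (a + 1) / (2 * b)) * b = - (a + 1) by field.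
  by lra.
have c_gt0 : 0 < c by rewrite lt_neqAle eq_sym c_neq0.
have := h (- b / c).
have -> : a + 2 * (- b / c) * b + (- b / c) ^+ 2 * c = (a * c - b ^+ 2) / c.
  by field.
by rewrite pmulr_lge0 ?invr_gt0// subr_ge0.
Qed.

(** The difference of the two sides is the sum of the squared deviations from the mean. *)
Lemma sum_sqr_ge (R : realFieldType) (m : nat) (e : 'I_m -> R) : (0 < m)%N ->
  (\sum_(j < m) e j) ^+ 2 / m%:R <= \sum_(j < m) e j ^+ 2.
Proof.
move=> m_gt0; set s := \sum_(j < m) e j.
have m0 : (m%:R : R) != 0 by rewrite pnatr_eq0 -lt0n.
rewrite -subr_ge0.
suff -> : \sum_(j < m) e j ^+ 2 - s ^+ 2 / m%:R = \sum_(j < m) (e j - s / m%:R) ^+ 2.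
  by apply: sumr_ge0 => j _; exact: sqr_ge0.
rewrite [RHS](eq_bigr (fun j => e j ^+ 2 - 2 * (s / m%:R) * e j + (s / m%:R) ^+ 2)).
  rewrite big_split sumrB /= -mulr_sumr sumr_const card_ord -mulr_natl -/s.
  by field.
by move=> j _; ring.
Qed.

Section linear_functions.
Context {K : nzRingType} {U V : lmodType K} {f : U -> V} (lin_f : linear f).

Lemma lin0 : f 0 = 0.
Proof. by have := lin_f (-1) 0 0; rewrite scaler0 add0r scaleN1r addNr. Qed.

Lemma linD x y : f (x + y) = f x + f y.
Proof. by have := lin_f 1 x y; rewrite !scale1r. Qed.

Lemma linZ a x : f (a *: x) = a *: f x.
Proof. by have := lin_f a x 0; rewrite lin0 !addr0. Qed.

Lemma linN x : f (- x) = - f x.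
Proof. by rewrite -scaleN1r linZ scaleN1r. Qed.

Lemma linB x y : f (x - y) = f x - f y.
Proof. by rewrite linD linN. Qed.

End linear_functions.

Section hilbert.
Context {R : realType} {H : completeNormedModType R[i]}.
Context (ip : {dot H for (@Num.conj R[i])}).

(** Passing to the real part loses nothing: the imaginary part of [ip x y] is the real part of
    [ip x ('i *: y)], as [ipE] records. Inequalities can then be handled in the ordered field
    [R]. *)
Definition rip (x y : H) : R := complex.Re (ip x y).

Local Notation "a '%:C'" := (real_complex R a).
Local Notation "<[ x , y ]>" := (rip x y) (format "<[ x ,  y ]>").

Lemma ripDl x y z : <[x + y, z]> = <[x, z]> + <[y, z]>.
Proof. by rewrite /rip linearDl raddfD. Qed.

Lemma ripDr x y z : <[z, x + y]> = <[z, x]> + <[z, y]>.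
Proof. by rewrite /rip linearDr raddfD. Qed.

Lemma ripNl x y : <[- x, y]> = - <[x, y]>.
Proof. by rewrite /rip linearNl raddfN. Qed.

Lemma ripNr x y : <[x, - y]> = - <[x, y]>.
Proof. by rewrite /rip linearNr raddfN. Qed.

Lemma ip_conj x y : ip x y = (ip y x)^*%C.
Proof. by have := @hermC _ _ _ _ ip x y; rewrite expr0 mul1r. Qed.

Lemma ripC x y : <[x, y]> = <[y, x]>.
Proof. by rewrite /rip ip_conj; case: (ip y x). Qed.

Let ReZ (a : R) (z : R[i]) : complex.Re (a%:C * z) = a * complex.Re z.
Proof. by case: z => b c /=; rewrite mul0r subr0. Qed.

Lemma ripZl (a : R) x y : <[a%:C *: x, y]> = a * <[x, y]>.
Proof. by rewrite /rip linearZl_LR ReZ. Qed.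

Lemma ripZr (a : R) x y : <[x, a%:C *: y]> = a * <[x, y]>.
Proof. by rewrite ripC ripZl ripC. Qed.

Lemma rip0l x : <[0, x]> = 0. Proof. by rewrite /rip linear0l. Qed.

Lemma rip0r x : <[x, 0]> = 0. Proof. by rewrite ripC rip0l. Qed.

Lemma ripIl x y : <['i%C *: x, y]> = - complex.Im (ip x y).
Proof. by rewrite /rip linearZl_LR mulrC ReiNIm. Qed.

Lemma ripIr x y : <[x, 'i%C *: y]> = complex.Im (ip x y).
Proof. by rewrite ripC ripIl ip_conj; case: (ip x y) => b c /=; rewrite opprK. Qed.

Definition ripE := (ripDl, ripDr, ripNl, ripNr, ripZl, ripZr).

Lemma ipE x y : ip x y = Complex <[x, y]> <[x, 'i%C *: y]>.
Proof. by rewrite ripIr /rip; case: (ip x y). Qed.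

Lemma rip_ge0 x : 0 <= <[x, x]>.
Proof.
have [->|x0] := eqVneq x 0; first by rewrite rip0l.
by have := @neq0_dnorm_gt0 _ _ _ ip _ x0; rewrite ltcE => /andP[_ /ltW].
Qed.

Lemma rip_eq0 x : <[x, x]> = 0 -> x = 0.
Proof.
move=> x0; apply/eqP; apply: contraT => xn0.
by have := @neq0_dnorm_gt0 _ _ _ ip _ xn0; rewrite ltcE/= -/(rip x x) x0 ltxx andbF.
Qed.

Lemma eq_rip x y : (forall z, <[x, z]> = <[y, z]>) -> x = y.
Proof.
by move=> h; apply/subr0_eq/rip_eq0; rewrite ripDl ripNl h subrr.
Qed.

Lemma eq_ip x y : (forall z, ip z x = ip z y) -> x = y.
Proof. by move=> h; apply: eq_rip => z; rewrite ripC [RHS]ripC /rip h. Qed.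

(* Positivity expressed with the real inner product only; boundedness is kept
   separate because every bound needed is one on the quadratic form. *)
Definition psd (T : H -> H) : Prop :=
  [/\ linear T, forall x y, <[T x, y]> = <[x, T y]> & forall x, 0 <= <[T x, x]>].

Lemma psd_cauchy_schwarz T x y : psd T ->
  <[T x, y]> ^+ 2 <= <[T x, x]> * <[T y, y]>.
Proof.
move=> [linT saT posT]; apply: square_le_discriminant => // t.
have := posT (x + t%:C *: y).
rewrite (linD linT) (linZ linT) !ripE.
by rewrite [<[T y, x]>]saT [<[y, T x]>]ripC; congr (0 <= _); ring.
Qed.

Lemma psd_id : psd idfun.
Proof. by split=> // x; exact: rip_ge0. Qed.

Lemma rip_cauchy_schwarz x y : <[x, y]> ^+ 2 <= <[x, x]> * <[y, y]>.
Proof. exact: psd_cauchy_schwarz psd_id. Qed.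

(** This is [T ^ 2 <= M T]. Cauchy-Schwarz for the form of [T] at [x] and [T x] bounds [|T x| ^ 4]
    by [<T x, x> * M |T x| ^ 2], and one factor [|T x| ^ 2] cancels. It is the device that turns
    bounds on forms into bounds on norms. *)
Lemma psd_norm_le T M x : psd T -> (forall x, <[T x, x]> <= M * <[x, x]>) ->
  <[T x, T x]> <= M * <[T x, x]>.
Proof.
move=> psdT leM; have [_ _ posT] := psdT.
have [->|Tx0] := eqVneq (T x) 0.
  by rewrite !rip0l mulr0.
have Txx : 0 < <[T x, T x]>.
  by rewrite lt_neqAle rip_ge0 andbT eq_sym; apply: contra_neq Tx0 => /rip_eq0.
have := psd_cauchy_schwarz x (T x) psdT.
have := ler_wpM2l (posT x) (leM (T x)).
move=> h1 h2; rewrite -(ler_pM2r Txx) -expr2 (le_trans h2)// (le_trans h1)//.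
by rewrite le_eqVlt; apply/orP; left; apply/eqP; ring.
Qed.

Lemma psd_norm_le2 T M x : psd T -> 0 <= M ->
  (forall x, <[T x, x]> <= M * <[x, x]>) ->
  <[T x, T x]> <= M ^+ 2 * <[x, x]>.
Proof.
move=> psdT M0 leM; rewrite (le_trans (psd_norm_le x psdT leM))//.
by rewrite expr2 -mulrA ler_wpM2l.
Qed.

Lemma psd_form_eq0 T x : psd T -> <[T x, x]> = 0 -> T x = 0.
Proof.
move=> psdT Tx0; apply: eq_rip => z; rewrite rip0l; apply/eqP.
rewrite -sqrf_eq0 eq_le sqr_ge0 andbT (le_trans (psd_cauchy_schwarz x z psdT))//.
by rewrite Tx0 mul0r.
Qed.

Lemma psd_add S T : psd S -> psd T -> psd (fun x => S x + T x).
Proof.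
move=> [linS saS posS] [linT saT posT]; split=> [a x y|x y|x].
- by rewrite linS linT scalerDr addrACA.
- by rewrite ripDl ripDr saS saT.
- by rewrite ripDl addr_ge0.
Qed.

Lemma psd_scale T (a : R) : 0 <= a -> psd T -> psd (fun x => a%:C *: T x).
Proof.
move=> a0 [linT saT posT]; split=> [b x y|x y|x].
- by rewrite linT scalerDr !scalerA mulrC.
- by rewrite ripZl ripZr saT.
- by rewrite ripZl mulr_ge0.
Qed.

Lemma psd_sub S T : psd S -> psd T -> (forall x, <[T x, x]> <= <[S x, x]>) ->
  psd (fun x => S x - T x).
Proof.
move=> [linS saS posS] [linT saT posT] le_TS; split=> [a x y|x y|x].
- by rewrite linS linT scalerBr opprD addrACA.
- by rewrite !ripE saS saT.
- by rewrite !ripE subr_ge0.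
Qed.

Lemma psd_conj S T : psd S -> psd T -> psd (fun x => S (T (S x))).
Proof.
move=> [linS saS posS] [linT saT posT]; split=> [a x y|x y|x].
- by rewrite linS linT linS.
- by rewrite saS saT saS.
- by rewrite saS.
Qed.

Lemma psd_sqr S : psd S -> psd (fun x => S (S x)).
Proof. by move=> psdS; apply: psd_conj psdS psd_id. Qed.

End hilbert.

(** * Strong limits of decreasing positive operators *)

Section hilbert_topology.
Context {R : realType} {H : completeNormedModType R[i]}.
Context (ip : {dot H for (@Num.conj R[i])}) (ip_norm : induces_norm ip).

Local Notation "a '%:C'" := (real_complex R a).
Local Notation rip := (rip ip).
Local Notation psd := (psd ip).
Local Notation "<[ x , y ]>" := (rip x y) (format "<[ x ,  y ]>").

Lemma norm_rip x : `|x| = (Num.sqrt <[x, x]>)%:C.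
Proof.
have nx := ip_norm x.
apply/eqP; rewrite -(@eqrXn2 _ 2%N)// ?ler0c ?sqrtr_ge0//.
rewrite -nx -rmorphXn/= sqr_sqrtr ?rip_ge0// ipE; apply/eqP.
congr Complex; rewrite ripIr.
by rewrite ger0_Im// nx exprn_ge0.
Qed.

Lemma norm_lt_rip x (e : R) : 0 < e -> (`|x| < e%:C) = (<[x, x]> < e ^+ 2).
Proof.
move=> e0; rewrite norm_rip ltcR -[in LHS](ger0_norm (ltW e0)) -sqrtr_sqr.
by rewrite ltr_sqrt// exprn_gt0.
Qed.

Lemma norm_le_rip x y (e : R) : 0 <= e ->
  (`|x| <= e%:C * `|y|) = (<[x, x]> <= e ^+ 2 * <[y, y]>).
Proof.
move=> e0; rewrite !norm_rip -rmorphM lecR -[in LHS](ger0_norm e0) -sqrtr_sqr.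
by rewrite -sqrtrM ?sqr_ge0// ler_sqrt// mulr_ge0 ?sqr_ge0 ?rip_ge0.
Qed.

Lemma complex_gt0E (e : R[i]) : 0 < e -> exists2 r : R, 0 < r & e = r%:C.
Proof.
by case: e => a b; rewrite ltcE/= => /andP[/eqP -> a0]; exists a.
Qed.

Let gt0c (r : R) : (0 < r%:C) = (0 < r). Proof. exact: (ltcR 0 r). Qed.

Lemma cvg_ripP (u : nat -> H) l :
  u n @[n --> \oo] --> l <->
  forall e : R, 0 < e -> \forall n \near \oo, <[l - u n, l - u n]> < e.
Proof.
split=> [/cvgrPdist_lt ul e e0|h].
  have := ul (Num.sqrt e)%:C; rewrite gt0c sqrtr_gt0 => /(_ e0).
  apply: filterS => n; rewrite norm_lt_rip ?sqrtr_gt0// sqr_sqrtr//.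
  exact: ltW.
apply/cvgrPdist_lt => _/complex_gt0E[r r0 ->].
have := h (r ^+ 2); rewrite exprn_gt0// => /(_ isT).
by apply: filterS => n; rewrite norm_lt_rip.
Qed.

Lemma cauchy_rip_cvg (u : nat -> H) :
  (forall e : R, 0 < e ->
    exists N, forall n, (N <= n)%N -> <[u N - u n, u N - u n]> < e) ->
  cvg (u n @[n --> \oo]).
Proof.
move=> h; apply/cauchy_cvgP/cauchy_exP => _/complex_gt0E[r r0 ->].
have := h (r ^+ 2); rewrite exprn_gt0// => /(_ isT)[N hN].
exists (u N); exists N => // n /= Nn.
by rewrite -ball_normE /ball_ /= norm_lt_rip// hN.
Qed.

Lemma cvg_ripl (u : nat -> H) l y :
  u n @[n --> \oo] --> l -> <[u n, y]> @[n --> \oo] --> <[l, y]>.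
Proof.
move=> /cvg_ripP ul; apply/cvgrPdist_lt => e e0.
have y1 : 0 < <[y, y]> + 1 by rewrite ltr_wpDl ?rip_ge0.
have := ul (e ^+ 2 / (<[y, y]> + 1)).
rewrite divr_gt0 ?exprn_gt0// => /(_ isT); apply: filterS => n.
rewrite ltr_pdivlMr// => hn.
rewrite -ripNl -ripDl -(@ltr_pXn2r _ 2) ?nnegrE// ?ltW// real_normK ?num_real//.
rewrite (le_lt_trans (rip_cauchy_schwarz _ _ _))// (le_lt_trans _ hn)//.
by rewrite ler_wpM2l ?rip_ge0// lerDl.
Qed.

(** The constant compares squared norms, so it corresponds to the square of an operator bound. *)
Lemma bounded_opP (T : H -> H) :
  bounded_op T <->
  linear T /\ exists2 M : R, 0 <= M & forall x, <[T x, T x]> <= M * <[x, x]>.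
Proof.
have key : forall linT : linear T, bounded_near T (nbhs (0 : H)) <->
    \forall r \near +oo, forall x : H, `|T x| <= r * `|x|.
  move=> linT.
  pose T' : {linear H -> H} := HB.pack T (GRing.isLinear.Build _ _ _ _ T linT).
  exact: (linear_boundedP T').
split=> -[linT].
  move=> /(key linT)[M [Mreal hM]]; split=> //.
  have [r r0 Mr] : exists2 r : R, 0 <= r & M < r%:C.
    exists (`|complex.Re M| + 1); first by rewrite addr_ge0.
    by rewrite -(RRe_real Mreal) ltcR ltr_pwDr// ler_norm.
  exists (r ^+ 2); first by rewrite exprn_ge0.
  by move=> x; rewrite -norm_le_rip//; exact: hM.
move=> [M M0 hM]; split=> //; apply/(key linT).
exists (Num.sqrt M)%:C; split; first by rewrite complex_real.
move=> r rM x; rewrite (@le_trans _ _ ((Num.sqrt M)%:C * `|x|))//.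
  by rewrite norm_le_rip ?sqrtr_ge0// sqr_sqrtr.
by rewrite ler_wpM2r// ltW.
Qed.

Lemma positive_opP (T : H -> H) :
  positive_op ip T <->
  psd T /\ exists2 M : R, 0 <= M & forall x, <[T x, x]> <= M * <[x, x]>.
Proof.
split=> [[/bounded_opP[linT [M M0 TM]] Tge0]|[psdT [M M0 TM]]].
  have saT x y : <[T x, y]> = <[x, T y]>.
    have real z : complex.Im (ip (T z) z) = 0 by exact: ger0_Im.
    (* Polarisation: since the form of [T] is real at [x], [y] and [x + 'i y], the cross terms must
       agree, which is symmetry. *)
    have := real (x + 'i%C *: y).
    rewrite (linD linT) (linZ linT) -ripIr scalerDr scalerA -expr2 sqr_i.
    rewrite scaleN1r !ripE.
    have -> : <[T x, 'i%C *: x]> = 0 by rewrite ripIr real.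
    have -> : <['i%C *: T y, y]> = 0 by rewrite ripIl real oppr0.
    have -> : <['i%C *: T y, 'i%C *: x]> = <[T y, x]>.
      by rewrite ripIr linearZl_LR mulrC ImiRe.
    by rewrite [<[x, T y]>]ripC; lra.
  split; last first.
    exists (Num.sqrt M); first exact: sqrtr_ge0.
    move=> x; rewrite -(@ler_pXn2r _ 2) ?nnegrE//; last 2 first.
    - by have := Tge0 x; rewrite lecE => /andP[].
    - by rewrite mulr_ge0 ?sqrtr_ge0 ?rip_ge0.
    rewrite (le_trans (rip_cauchy_schwarz _ _ _))// exprMn sqr_sqrtr//.
    by rewrite [X in _ <= _ * X]expr2 mulrA ler_wpM2r// rip_ge0.
  by split=> // x; have := Tge0 x; rewrite lecE => /andP[].
have [linT saT posT] := psdT.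
split; last first.
  move=> x; rewrite ipE lecE/= posT andbT; apply/eqP.
  (* Symmetry makes the imaginary part of [ip (T x) x] equal to its own opposite. *)
  have : <['i%C *: T x, x]> = - <['i%C *: T x, x]>.
    by rewrite -{1}(linZ linT) saT ripC ripIr ripIl opprK.
  rewrite ripIl ripIr; lra.
apply/bounded_opP; split=> //; exists (M ^+ 2); first by rewrite exprn_ge0.
by move=> x; exact: (psd_norm_le2 x psdT).
Qed.

Section monotone_limit.
Variables (T : nat -> H -> H) (M : R).
Hypotheses (psdT : forall n, psd (T n)) (M_ge0 : 0 <= M).
Hypothesis T0_le : forall x, <[T 0 x, x]> <= M * <[x, x]>.
Hypothesis T_decr : forall n x, <[T n.+1 x, x]> <= <[T n x, x]>.

Lemma form_nonincreasing x : nonincreasing_seq (fun n => <[T n x, x]>).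
Proof. exact/nonincreasing_seqP. Qed.

(** The numbers [<T n x, x>] decrease and are nonnegative, hence converge. For [N <= n] the operator
    [T N - T n] lies between [0] and [M], so [psd_norm_le] bounds [|T N x - T n x| ^ 2] by [M] times
    a difference of these numbers. *)
Lemma decreasing_psd_is_cvg x : cvg (T n x @[n --> \oo]).
Proof.
set a := fun n => <[T n x, x]>.
have a_ge0 n : 0 <= a n by have [_ _] := psdT n; exact.
have a_cvg : cvgn a.
  apply: nonincreasing_is_cvgn; first exact: form_nonincreasing.
  by exists 0 => _ [n _ <-].
apply: cauchy_rip_cvg => e e0.
(* [M + 1] replaces [M] as a divisor, since [M] may be [0]. *)
have M1 : 0 < M + 1 by rewrite ltr_wpDl.
have /cvgrPdist_lt /(_ (e / (M + 1))) := a_cvg; rewrite divr_gt0// => /(_ isT).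
move=> [N _ /(_ N (leqnn N))/=]; rewrite ltr_pdivlMr// => aN.
exists N => n Nn.
have psdD := psd_sub (psdT N) (psdT n) (fun y => form_nonincreasing y Nn).
have leD y : <[T N y - T n y, y]> <= M * <[y, y]>.
  rewrite ripDl ripNl (le_trans _ (T0_le y))//.
  rewrite (le_trans _ (form_nonincreasing y (leq0n N)))//.
  by rewrite gerBl; have [_ _] := psdT n; exact.
have := psd_norm_le x psdD leD; move=> /le_lt_trans; apply.
apply: le_lt_trans aN; rewrite mulrC ripDl ripNl -/(a N) -/(a n).
have la : limn a <= a n by exact: (nonincreasing_cvgn_ge (form_nonincreasing x)).
have laN : limn a <= a N by exact: (nonincreasing_cvgn_ge (form_nonincreasing x)).
have anN : a n <= a N by exact: form_nonincreasing.
rewrite distrC ger0_norm ?subr_ge0//.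
apply: (@le_trans _ _ ((a N - a n) * (M + 1))).
  by rewrite ler_wpM2l ?subr_ge0// lerDl.
by rewrite ler_wpM2r ?lerB// ltW.
Qed.

Lemma strong_limE x : T n x @[n --> \oo] --> strong_lim T x.
Proof. exact: decreasing_psd_is_cvg. Qed.

Lemma strong_lim_form x : <[T n x, x]> @[n --> \oo] --> <[strong_lim T x, x]>.
Proof. exact/cvg_ripl/strong_limE. Qed.

Lemma strong_lim_psd : psd (strong_lim T).
Proof.
split=> [a x y|x y|x].
- apply: cvg_lim => //.
  have -> : (fun n => T n (a *: x + y)) = (fun n => a *: T n x + T n y).
    by apply/funext => n; have [linT _ _] := psdT n; rewrite linT.
  by apply: cvgD; [apply: cvgZ; first exact: cvg_cst|]; exact: strong_limE.
- have /cvg_lim <-// := @cvg_ripl _ _ y (@strong_limE x).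
  rewrite ripC; have /cvg_lim <-// := @cvg_ripl _ _ x (@strong_limE y).
  suff -> : (fun n => <[T n x, y]>) = (fun n => <[T n y, x]>) by [].
  by apply/funext => n; have [_ saT _] := psdT n; rewrite saT ripC.
- apply: (cvgr_to_ge (@strong_lim_form x)); apply: nearW => n.
  by have [_ _] := psdT n; exact.
Qed.

Lemma strong_lim_form_le n x : <[strong_lim T x, x]> <= <[T n x, x]>.
Proof.
have /cvg_lim <-// := @strong_lim_form x.
apply: (nonincreasing_cvgn_ge (form_nonincreasing x)).
by apply/cvg_ex; exists <[strong_lim T x, x]>; exact: strong_lim_form.
Qed.

End monotone_limit.

End hilbert_topology.

(** * Square roots *)

Section square_root.
Context {R : realType} {H : completeNormedModType R[i]}.
Context (ip : {dot H for (@Num.conj R[i])}) (ip_norm : induces_norm ip).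

Local Notation "a '%:C'" := (real_complex R a).
Local Notation rip := (rip ip).
Local Notation psd := (psd ip).
Local Notation "<[ x , y ]>" := (rip x y) (format "<[ x ,  y ]>").

(** * Products of commuting positive operators *)

Section product_iteration.
Variables S T : H -> H.
Hypotheses (psdS : psd S) (psdT : psd T).
Hypothesis T_le1 : forall x, <[T x, x]> <= <[x, x]>.
Hypothesis ST_comm : forall x, S (T x) = T (S x).

(** The recursion is [N k.+1 = N k - N k ^ 2] from [N 0 = T], so that [T] telescopes into squares of
    operators commuting with [S]. *)
Fixpoint product_iter (k : nat) (x : H) : H :=
  if k is k'.+1 then product_iter k' x - product_iter k' (product_iter k' x)
  else T x.

Local Notation N := product_iter.

(** If [0 <= N k <= 1], then [N k ^ 2 <= N k] by [psd_norm_le], so the next iterate stays in the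
    same range. *)
Lemma product_iter_psd k : psd (N k) /\ forall x, <[N k x, x]> <= <[x, x]>.
Proof.
elim: k => [//|k [psdN N_le1]] /=.
have leN x : <[N k (N k x), x]> <= <[N k x, x]>.
  have [_ saN _] := psdN; rewrite saN -[leRHS]mul1r.
  by apply: psd_norm_le => // y; rewrite mul1r.
split; first exact: psd_sub psdN (psd_sqr psdN) leN.
move=> x; rewrite ripDl ripNl (le_trans _ (N_le1 x))// gerBl.
by have [_ _] := psd_sqr psdN; exact.
Qed.

Lemma product_iter_comm k x : S (N k x) = N k (S x).
Proof.
have [linS _ _] := psdS.
by elim: k x => [//|k IHk] x /=; rewrite (linB linS) !IHk.
Qed.

Lemma product_iter_form k x :
  <[N k.+1 x, x]> = <[N k x, x]> - <[N k x, N k x]>.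
Proof.
have [[_ saN _] _] := product_iter_psd k; rewrite [N k.+1 x]/= ripDl ripNl.
by rewrite [X in _ - X]saN.
Qed.

(** By [product_iter_form], [|N k x| ^ 2] is the difference of consecutive terms of the convergent
    sequence [<N k x, x>]. *)
Lemma product_iter_cvg0 x : N k x @[k --> \oo] --> (0 : H).
Proof.
have psdN k : psd (N k) by have [] := product_iter_psd k.
have N_decr k y : <[N k.+1 y, y]> <= <[N k y, y]>.
  by rewrite product_iter_form gerBl rip_ge0.
have T_le y : <[N 0 y, y]> <= 1 * <[y, y]> by rewrite mul1r; exact: T_le1.
have cvgN := @strong_lim_form _ _ _ ip_norm _ _ psdN ler01 T_le N_decr x.
have cvgNS : <[N k.+1 x, x]> @[k --> \oo] --> <[strong_lim N x, x]>.
  by rewrite (cvg_shiftS (fun k => <[N k x, x]>)).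
have /cvgrPdist_lt cvg0 : <[N k x, x]> - <[N k.+1 x, x]> @[k --> \oo] --> (0 : R).
  by rewrite -(subrr <[strong_lim N x, x]>); exact: cvgB.
apply/(cvg_ripP ip_norm) => e /cvg0; apply: filterS => k.
rewrite product_iter_form subKr sub0r normrN sub0r ripNl ripNr opprK.
exact/le_lt_trans/ler_norm.
Qed.

(* [S T] is the sum of the positive operators [N k S N k], because
   [N k - N k.+1 = N k ^ 2] and [N k] tends to [0]. *)
Lemma product_iter_form_ge0 x : 0 <= <[S (T x), x]>.
Proof.
have [linS saS posS] := psdS.
have decr : forall k, <[S (N k x), x]> <= <[S (T x), x]>.
  elim=> [//|k]; apply: le_trans; rewrite /= (linB linS) ripDl ripNl gerBl.
  have [[_ saN _] _] := product_iter_psd k.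
  by rewrite product_iter_comm saN.
have := @cvg_ripl _ _ _ ip_norm _ _ (S x) (product_iter_cvg0 x).
rewrite rip0l => cvg0; apply: (cvgr_to_le cvg0); apply: nearW => k.
by rewrite -saS.
Qed.

End product_iteration.

(** Scaling [T] by [(M + 1)^-1] brings it below the identity, where [product_iter_form_ge0]
    applies. *)
Lemma psd_comp_comm S T M : psd S -> psd T -> 0 <= M ->
  (forall x, <[T x, x]> <= M * <[x, x]>) ->
  (forall x, S (T x) = T (S x)) -> psd (S \o T).
Proof.
move=> psdS psdT M0 T_le comm.
have [[linS saS posS] [linT saT posT]] := (psdS, psdT).
split=> [a x y|x y|x] /=; first by rewrite linT linS.
- by rewrite saS saT comm.
have M1 : 0 < M + 1 by rewrite ltr_wpDl.
have M1V : 0 <= (M + 1)^-1 by rewrite invr_ge0 ltW.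
have := product_iter_form_ge0 psdS (psd_scale M1V psdT) _ _ x.
rewrite (linZ linS) ripZl pmulr_rge0 ?invr_gt0//; apply.
  move=> y; rewrite ripZl ler_pdivrMl// (le_trans (T_le y))//.
  by rewrite ler_wpM2r ?rip_ge0// lerDl.
by move=> y; rewrite (linZ linS) comm.
Qed.

(** * The square root of a positive operator below the identity *)

Section square_root_iteration.
Variable A : H -> H.
Hypotheses (psdA : psd A) (A_le1 : forall x, <[A x, x]> <= <[x, x]>).

(* With [A = 1 - B], this increases to the solution of [Y = (B + Y ^ 2) / 2],
   and then [(1 - Y) ^ 2 = A]. *)
Fixpoint sqrt_iter (n : nat) (x : H) : H :=
  if n is n'.+1 then (2^-1)%:C *: ((x - A x) + sqrt_iter n' (sqrt_iter n' x))
  else 0.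

Local Notation Y := sqrt_iter.

Let psdB : psd (fun x => x - A x).
Proof. exact: psd_sub (psd_id ip) psdA A_le1. Qed.

Let half_ge0 : 0 <= 2^-1 :> R. Proof. by rewrite invr_ge0. Qed.

Lemma sqrt_iter_psd n : psd (Y n).
Proof.
elim: n => [|n psdY] /=; last first.
  exact: psd_scale half_ge0 (psd_add psdB (psd_sqr psdY)).
by split=> [a x y|x y|x]; rewrite ?scaler0 ?addr0 ?rip0l ?rip0r.
Qed.

Lemma sqrt_iter_form n x : <[Y n.+1 x, x]> =
  2^-1 * (<[x, x]> - <[A x, x]> + <[Y n (Y n x), x]>).
Proof. by rewrite /= !ripE. Qed.

(** By induction [Y n ^ 2 <= Y n <= 1], so [Y n.+1] is half of a sum of two operators below the
    identity. *)
Lemma sqrt_iter_le1 n x : <[Y n x, x]> <= <[x, x]>.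
Proof.
elim: n x => [|n IHn] x /=; first by rewrite rip0l rip_ge0.
have [_ saY _] := sqrt_iter_psd n.
have [_ _ posA] := psdA.
have YY : <[Y n x, Y n x]> <= 1 * <[Y n x, x]>.
  by apply: psd_norm_le => [|y]; [exact: sqrt_iter_psd|rewrite mul1r].
rewrite ripZl !ripDl ripNl saY.
by have := IHn x; have := posA x; lra.
Qed.

(** Each [Y n] is a polynomial in [A]. *)
Lemma sqrt_iter_comm W n x : linear W -> (forall x, W (A x) = A (W x)) ->
  W (Y n x) = Y n (W x).
Proof.
move=> linW comm; elim: n x => [|n IHn] x /=; first by rewrite (lin0 linW).
by rewrite (linZ linW) (linD linW) (linB linW) comm !IHn.
Qed.

Lemma sqrt_iter_comm_iter m n x : Y m (Y n x) = Y n (Y m x).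
Proof.
have [linY _ _] := sqrt_iter_psd m; have [linA _ _] := psdA.
by apply: sqrt_iter_comm => // y; rewrite -sqrt_iter_comm.
Qed.

(** Twice the increment [Y n.+2 - Y n.+1] is [Y n.+1 ^ 2 - Y n ^ 2], which factors as
    [(Y n.+1 - Y n) (Y n.+1 + Y n)]. The factors commute and are positive, the first by induction,
    so [psd_comp_comm] applies. *)
Lemma sqrt_iter_incr n x : <[Y n x, x]> <= <[Y n.+1 x, x]>.
Proof.
elim: n x => [|n IHn] x.
  by rewrite rip0l; have [_ _] := sqrt_iter_psd 1; exact.
have [[linY saY _] [linY' saY' _]] := (sqrt_iter_psd n, sqrt_iter_psd n.+1).
have psdD := psd_sub (sqrt_iter_psd n.+1) (sqrt_iter_psd n) IHn.
have psdP := psd_add (sqrt_iter_psd n.+1) (sqrt_iter_psd n).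
have P_le2 y : <[Y n.+1 y + Y n y, y]> <= 2 * <[y, y]>.
  by rewrite ripDl; have := sqrt_iter_le1 n y; have := sqrt_iter_le1 n.+1 y; lra.
have comm y : Y n.+1 (Y n.+1 y + Y n y) - Y n (Y n.+1 y + Y n y) =
              Y n.+1 (Y n.+1 y - Y n y) + Y n (Y n.+1 y - Y n y).
  rewrite (linD linY) (linD linY') (linB linY) (linB linY').
  by rewrite sqrt_iter_comm_iter addrKA subrKA.
have [_ _ /(_ x)] := psd_comp_comm psdD psdP (ler0n _ 2) P_le2 comm.
rewrite -[(_ \o _) x]/(Y n.+1 (Y n.+1 x + Y n x) - Y n (Y n.+1 x + Y n x)).
rewrite comm (linB linY) (linB linY') [Y n.+1 (Y n x)]sqrt_iter_comm_iter subrKA.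
rewrite ripDl ripNl subr_ge0 => le_sqr.
rewrite [sqrt_iter n.+2]lock !sqrt_iter_form -lock sqrt_iter_form.
by rewrite ler_pM2l// lerD2l.
Qed.

Let X (n : nat) (x : H) : H := x - Y n x.

Let psdX n : psd (X n).
Proof. exact: psd_sub (psd_id ip) (sqrt_iter_psd n) (sqrt_iter_le1 n). Qed.

Let X_le1 n x : <[X n x, x]> <= 1 * <[x, x]>.
Proof.
rewrite mul1r /X ripDl ripNl gerBl.
by have [_ _] := sqrt_iter_psd n; exact.
Qed.

Let X_decr n x : <[X n.+1 x, x]> <= <[X n x, x]>.
Proof. by rewrite ripDl ripNl [leRHS]ripDl ripNl lerB// sqrt_iter_incr. Qed.

(** The recursion rewritten for [X = 1 - Y]; the correction to [A] vanishes in the limit. *)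
Let X_sqr n x : X n (X n x) = A x + (2%:C *: X n x - 2%:C *: X n.+1 x).
Proof.
have [linY _ _] := sqrt_iter_psd n.
by apply: (@eq_rip _ _ ip) => z; rewrite /X (linB linY) /= !ripE; lra.
Qed.

Lemma psd_sqrt_contraction :
  exists S, [/\ psd S, forall x, <[S x, x]> <= <[x, x]> & S \o S = A].
Proof.
set L := strong_lim X.
have cvgX x : X n x @[n --> \oo] --> L x.
  exact: (strong_limE ip_norm psdX ler01 (X_le1 0) X_decr).
have psdL : psd L := strong_lim_psd ip_norm psdX ler01 (X_le1 0) X_decr.
have L_le1 x : <[L x, x]> <= <[x, x]>.
  apply: le_trans (strong_lim_form_le ip_norm psdX ler01 (X_le1 0) X_decr 0 x) _.
  by rewrite -[leRHS]mul1r.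
exists L; split=> //; apply/funext => x /=.
have cvgXX : X n (X n x) @[n --> \oo] --> L (L x).
  (* Both the operator and its argument vary with [n]. The first summand tends to [0] because every
     [X n] is a contraction, the second by strong convergence at [L x]. *)
  have -> : (fun n => X n (X n x)) = (fun n => X n (X n x - L x) + X n (L x)).
    apply/funext => n; have [linX _ _] := psdX n.
    by rewrite (linB linX (X n x) (L x)) subrK.
  rewrite -[L (L x)]add0r; apply: cvgD; last exact: cvgX.
  apply/(cvg_ripP ip_norm) => e e0.
  have /(cvg_ripP ip_norm)/(_ e e0) := cvgX x; apply: filterS => n.
  apply: le_lt_trans; rewrite sub0r ripNl ripNr opprK.
  rewrite (le_trans (psd_norm_le2 _ (psdX n) ler01 (X_le1 n)))//.
  by rewrite expr1n mul1r -(opprB (L x)) ripNl ripNr opprK.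
suff cvgA : X n (X n x) @[n --> \oo] --> A x.
  by rewrite -(cvg_lim _ cvgXX)// (cvg_lim _ cvgA).
under eq_fun do rewrite X_sqr.
have cvg2X : 2%:C *: X n x @[n --> \oo] --> 2%:C *: L x.
  by apply: cvgZ; [exact: cvg_cst|exact: cvgX].
have cvg2XS : 2%:C *: X n.+1 x @[n --> \oo] --> 2%:C *: L x.
  by rewrite (cvg_shiftS (fun n => 2%:C *: X n x)).
have := cvgD (@cvg_cst _ (A x) _ \oo _) (cvgB cvg2X cvg2XS).
by rewrite subrr addr0; exact.
Qed.

End square_root_iteration.

(** The root of [A / (M + 1)] is multiplied back by the square root of [M + 1]. *)
Lemma positive_sqrt_exists A : positive_op ip A ->
  exists S, positive_op ip S /\ S \o S = A.
Proof.
move=> /(positive_opP ip_norm)[psdA [M M0 A_le]].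
have M1 : 0 < M + 1 by rewrite ltr_wpDl.
have M1V : 0 <= (M + 1)^-1 by rewrite invr_ge0 ltW.
have [x|S [psdS S_le1 SS]] := psd_sqrt_contraction (psd_scale M1V psdA).
  rewrite ripZl ler_pdivrMl// (le_trans (A_le x))//.
  by rewrite ler_wpM2r ?rip_ge0// lerDl.
exists (fun x => (Num.sqrt (M + 1))%:C *: S x); split.
  apply/(positive_opP ip_norm); split; first exact: psd_scale (sqrtr_ge0 _) psdS.
  exists (Num.sqrt (M + 1)); first exact: sqrtr_ge0.
  by move=> x; rewrite ripZl ler_wpM2l ?sqrtr_ge0.
apply/funext => x /=; have [linS _ _] := psdS.
rewrite (linZ linS) -[S (S x)]/((S \o S) x) SS !scalerA -!rmorphM /=.
by rewrite -expr2 sqr_sqrtr ?ltW// divff ?gt_eqF// scale1r.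
Qed.

(* [D = S - T] satisfies [S D = - D T], so [D ^ 2] commutes with [T], and
   [T D ^ 2 = - D S D] is both positive and negative. *)
Let sqrt_unique_aux S T M : psd S -> psd T -> 0 <= M ->
  (forall x, <[T x, x]> <= M * <[x, x]>) -> (forall x, S (S x) = T (T x)) ->
  forall x, S (S x - T x) = 0.
Proof.
move=> psdS psdT M0 T_le SSTT x.
have [[linS saS posS] [linT saT posT]] := (psdS, psdT).
pose D y := S y - T y.
have saD y z : <[D y, z]> = <[y, D z]> by rewrite /D !ripE saS saT.
have linD : linear D.
  by move=> a y z; rewrite /D linS linT scalerBr opprD addrACA.
have SD y : S (D y) = - D (T y) by rewrite /D (linB linS) SSTT opprB.
have DS y : D (S y) = - T (D y) by rewrite /D (linB linT) SSTT opprB.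
have psdDD : psd (fun y => D (D y)).
  split=> [a y z|y z|y]; first by rewrite !linD.
  - by rewrite !saD.
  - by rewrite saD rip_ge0.
have comm y : D (D (T y)) = T (D (D y)).
  by rewrite -[D (T y)]opprK -SD (linN linD) DS opprK.
have [_ _ /(_ x) /= TDD_ge0] := psd_comp_comm psdDD psdT M0 T_le comm.
apply: psd_form_eq0 psdS _; apply/eqP; rewrite eq_le posS andbT.
by rewrite -oppr_ge0 -saD -ripNl DS opprK -comm.
Qed.

(** With [D = S - T], the previous lemma used in both orders gives [S D = T D = 0]. Hence
    [D ^ 2 = 0], and [D] vanishes because it is symmetric. *)
Lemma positive_sqrt_unique S T : positive_op ip S -> positive_op ip T ->
  S \o S = T \o T -> S = T.
Proof.
move=> /(positive_opP ip_norm)[psdS [M M0 S_le]].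
move=> /(positive_opP ip_norm)[psdT [M' M'0 T_le]] SSTT.
have SSTTx x : S (S x) = T (T x) by exact: (congr1 (@^~ x) SSTT).
have SD := sqrt_unique_aux psdS psdT M'0 T_le SSTTx.
have TD := sqrt_unique_aux psdT psdS M0 S_le (fun x => esym (SSTTx x)).
have [[linS saS posS] [linT saT posT]] := (psdS, psdT).
apply/funext => x; apply/subr0_eq/(rip_eq0 (ip := ip)).
rewrite [LHS]ripDl ripNl saS saT SD -opprB (linN linT) TD.
by rewrite oppr0 rip0r subrr.
Qed.

Lemma op_sqrtP A : positive_op ip A ->
  positive_op ip (op_sqrt ip A) /\ op_sqrt ip A \o op_sqrt ip A = A.
Proof.
move=> /positive_sqrt_exists.
exact: (@getPex _ [set S | positive_op ip S /\ S \o S = A]).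
Qed.

Lemma op_sqrt_sqr S : positive_op ip S -> op_sqrt ip (S \o S) = S.
Proof.
move=> posS.
have [] := @getPex _ [set T | positive_op ip T /\ T \o T = S \o S].
  by exists S.
by move=> posT TT; exact: positive_sqrt_unique.
Qed.

End square_root.

(** * Adjoints and orthonormal bases *)

Section adjoint_and_basis.
Context {R : realType} {H : completeNormedModType R[i]}.
Context (ip : {dot H for (@Num.conj R[i])}) (ip_norm : induces_norm ip).

Local Notation "a '%:C'" := (real_complex R a).
Local Notation rip := (rip ip).
Local Notation psd := (psd ip).
Local Notation "<[ x , y ]>" := (rip x y) (format "<[ x ,  y ]>").

(* The representing vector is the limit of a minimising sequence of
   [<x, x> - 2 g x]. *)
Lemma riesz_real (g : H -> R) (K : R) :
  (forall x y, g (x + y) = g x + g y) ->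
  (forall (a : R) x, g (a%:C *: x) = a * g x) ->
  0 <= K -> (forall x, g x ^+ 2 <= K * <[x, x]>) ->
  exists z, forall x, g x = <[x, z]>.
Proof.
move=> gD gZ K0 g_le.
pose J x := <[x, x]> - 2 * g x.
have J_ge x : - K <= J x.
  rewrite /J lerBrDr addrC lerBlDr (le_trans (ler_norm _))//.
  (* After squaring, [2 g x <= <x, x> + K] follows from [4 K <x, x> <= (<x, x> + K) ^ 2]. *)
  rewrite -(@ler_pXn2r _ 2) ?nnegrE ?addr_ge0 ?rip_ge0// real_normK ?num_real//.
  by have := g_le x; have := sqr_ge0 (<[x, x]> - K); lra.
pose d := inf (range J).
have J_lb : has_lbound (range J) by exists (- K) => _ [x _ <-].
have d_le x : d <= J x by apply: ge_inf => //; exists x.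
have /choice[u Ju] (n : nat) : exists x, J x < d + n.+1%:R^-1.
  have [||_ [x _ <-] ?] := @inf_adherent _ (range J) n.+1%:R^-1; last by exists x.
  - by rewrite invr_gt0.
  - by split=> //; exists (J 0); exists 0.
(* As [J] is at least [d] at the midpoint, two points whose values of [J] are close to [d] are close
   to each other. *)
have parallelogram x y :
    <[x - y, x - y]> = 2 * (J x + J y) - 4 * J ((2^-1)%:C *: (x + y)).
  by rewrite /J gZ gD !ripE (ripC _ y x); field.
have cvgu : cvg (u n @[n --> \oo]).
  apply: (cauchy_rip_cvg ip_norm) => e e0.
  have /cvgrPdist_lt /(_ (e / 4)) := @cvg_harmonic R.
  rewrite divr_gt0// => /(_ isT)[N _ hN]; exists N => n Nn.
  rewrite parallelogram.
  have hn k : (N <= k)%N -> k.+1%:R^-1 < e / 4.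
    by move=> /hN; rewrite /= sub0r normrN ger0_norm.
  have := hn _ (leqnn N); have := hn _ Nn; have := Ju N; have := Ju n.
  have := d_le ((2^-1)%:C *: (u N + u n)).
  by move: (N.+1%:R^-1) (n.+1%:R^-1) => a b *; lra.
exists (lim (u n @[n --> \oo])) => h; apply/esym/subr0_eq/eqP.
rewrite -sqrf_eq0 eq_le sqr_ge0 andbT.
(* Since [J (u n + t h) >= d > J (u n) - 1 / (n + 1)] for every [t], a quadratic in [t] is
   nonnegative; its discriminant gives the bound. *)
have near_min n : (<[u n, h]> - g h) ^+ 2 <= n.+1%:R^-1 * <[h, h]>.
  apply: square_le_discriminant; first exact: rip_ge0.
  move=> t; have := d_le (u n + t%:C *: h); have := Ju n.
  by rewrite /J gD gZ !ripE [<[h, u n]>]ripC; move: (n.+1%:R^-1) => a *; lra.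
have := @cvg_ripl _ _ _ ip_norm _ _ h cvgu; rewrite ripC => cvguh.
have cvgl2 : (<[u n, h]> - g h) * (<[u n, h]> - g h) @[n --> \oo] -->
    (<[h, lim (u n @[n --> \oo])]> - g h) * (<[h, lim (u n @[n --> \oo])]> - g h).
  by apply: cvgM; (apply: cvgB; [exact: cvguh|exact: cvg_cst]).
have cvgr : n.+1%:R^-1 * <[h, h]> @[n --> \oo] --> 0 * <[h, h]>.
  by apply: cvgM; [exact: cvg_harmonic|exact: cvg_cst].
rewrite expr2 -[leRHS](mul0r <[h, h]>).
by apply: (ler_cvg_to cvgl2 cvgr); apply: nearW.
Qed.

Lemma eq_ip_adjoint (S T : H -> H) : linear S -> linear T ->
  (forall x y, <[T x, y]> = <[x, S y]>) -> forall x y, ip (T x) y = ip x (S y).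
Proof.
by move=> linS linT adj x y; rewrite !ipE !adj (linZ linS).
Qed.

Lemma adjoint_exists T : bounded_op T ->
  exists S, bounded_op S /\ forall x y, ip (T x) y = ip x (S y).
Proof.
move=> /(bounded_opP ip_norm)[linT [M M0 T_le]].
have /choice[S adj] : forall y, exists z, forall x, <[T x, y]> = <[x, z]>.
  move=> y; apply: (@riesz_real _ (M * <[y, y]>)).
  - by move=> x z; rewrite (linD linT) ripDl.
  - by move=> a x; rewrite (linZ linT) ripZl.
  - by rewrite mulr_ge0 ?rip_ge0.
  move=> x; rewrite (le_trans (rip_cauchy_schwarz _ _ _))// mulrAC.
  by rewrite ler_wpM2r ?rip_ge0.
(* [S] is not yet known to be linear, so ['i] is moved to the first argument, where linearity of [T]
   handles it. *)
have adjip x y : ip (T x) y = ip x (S y).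
  rewrite ipE [RHS]ipE adj !ripIr; congr Complex; apply: oppr_inj.
  by rewrite -!ripIl -(linZ linT) adj.
exists S; split=> //; apply/(bounded_opP ip_norm); split.
  move=> a x y; apply: (@eq_ip _ _ ip) => z.
  by rewrite -adjip !linearDr !linearZr_LR /= !adjip.
exists M => // x.
have [->|Sx0] := eqVneq (S x) 0; first by rewrite rip0l mulr_ge0 ?rip_ge0.
have Sxx : 0 < <[S x, S x]>.
  by rewrite lt_neqAle rip_ge0 andbT eq_sym; apply: contra_neq Sx0 => /rip_eq0.
rewrite -(ler_pM2r Sxx) -expr2 -{1}adj.
rewrite (le_trans (rip_cauchy_schwarz _ _ _))// mulrAC.
by rewrite ler_wpM2r ?rip_ge0.
Qed.

Lemma adjointP T : bounded_op T ->
  bounded_op (adjoint ip T) /\ forall x y, ip (T x) y = ip x (adjoint ip T y).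
Proof.
move=> /adjoint_exists.
exact: (@getPex _ [set S | bounded_op S /\ forall x y, ip (T x) y = ip x (S y)]).
Qed.

Lemma adjoint_positive T : positive_op ip T -> adjoint ip T = T.
Proof.
move=> posT; have [[_ saT _] _] := (positive_opP ip_norm T).1 posT.
have [_ adjT] := adjointP posT.1.
apply/funext => y; apply: (@eq_ip _ _ ip) => x.
have [linT _] := posT.1.
by rewrite -adjT (eq_ip_adjoint linT).
Qed.

(** Here [adjoint T \o T] is [T \o T], whose unique positive root is [T]. For a positive operator,
    trace class thus gives a finite trace. *)
Lemma op_abs_positive T : positive_op ip T -> op_abs ip T = T.
Proof. by move=> posT; rewrite /op_abs adjoint_positive// op_sqrt_sqr. Qed.

(** A nonzero vector orthogonal to a maximal orthonormal family could be normalised and added to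
    it. *)
Lemma orthonormal_basis_exists : exists E, orthonormal_basis ip E.
Proof.
pose orthonormal (E : set H) := forall e f, E e -> E f -> ip e f = (e == f)%:R.
have [F oF Ftot|E [oE maxE]] := @Zorn_bigcup H orthonormal.
  move=> e f [A FA Ae] [B FB Bf].
  have [AB|BA] := Ftot A B FA FB; [apply: (oF B FB)|apply: (oF A FA)] => //.
  - exact: AB.
  - exact: BA.
exists E; split=> // x xE; apply/eqP; apply: contraT => x0.
have xx : 0 < <[x, x]>.
  by rewrite lt_neqAle rip_ge0 andbT eq_sym; apply: contra_neq x0 => /rip_eq0.
pose a := (Num.sqrt <[x, x]>)^-1.
pose e0 := a%:C *: x.
have e0E e : E e -> ip e0 e = 0 by move=> /xE xe; rewrite linearZl_LR /= xe mulr0.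
have Ee0 e : E e -> ip e e0 = 0 by move=> /e0E e0e; rewrite ip_conj e0e conjc0.
have e00 : ip e0 e0 = 1.
  have -> : ip e0 e0 = `|e0| ^+ 2 := ip_norm e0.
  rewrite (norm_rip ip_norm) !ripE mulrA -expr2 exprVn sqr_sqrtr ?ltW//.
  by rewrite mulVf ?gt_eqF// sqrtr1 expr1n.
have e0NE : ~ E e0 by move=> /e0E; rewrite e00 => /eqP; rewrite oner_eq0.
exfalso; apply: (maxE (E `|` [set e0])).
  split; first by move=> e Ee; left.
  by move=> h; apply: e0NE; apply: h; right.
move=> e f [Ee|->] [Ef|->].
- exact: oE.
- by rewrite Ee0//; case: eqP => // ee0; move: Ee; rewrite ee0.
- by rewrite e0E//; case: eqP => // ee0; move: Ef; rewrite -ee0.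
- by rewrite eqxx.
Qed.

Lemma basisP : orthonormal_basis ip (get (orthonormal_basis ip)).
Proof. exact: (@getPex _ (orthonormal_basis ip) orthonormal_basis_exists). Qed.

End adjoint_and_basis.

(** * Traces of the residuals *)

Section traces.
Context {R : realType} {H : completeNormedModType R[i]}.
Context (ip : {dot H for (@Num.conj R[i])}) (ip_norm : induces_norm ip).

Local Notation rip := (rip ip).
Local Notation psd := (psd ip).
Local Notation "<[ x , y ]>" := (rip x y) (format "<[ x ,  y ]>").

Lemma positive_op_psd T : positive_op ip T -> psd T.
Proof. by move=> /(positive_opP ip_norm)[]. Qed.

Lemma trace_psd_ge0 T : psd T -> (0 <= trace ip T)%E.
Proof. by move=> [_ _ posT]; apply: esum_ge0 => e _; rewrite lee_fin posT. Qed.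

Lemma trace_psd_add S T : psd S -> psd T ->
  trace ip (S \+ T) = (trace ip S + trace ip T)%E.
Proof.
move=> [_ _ posS] [_ _ posT].
rewrite /trace -esumD => [|e _|e _]; last 2 first.
- by rewrite lee_fin posS.
- by rewrite lee_fin posT.
by apply: eq_esum => e _; rewrite -EFinD -/(rip _ _) ripDl.
Qed.

Lemma form_le_trace T e : psd T -> get (orthonormal_basis ip) e ->
  (<[T e, e]>%:E <= trace ip T)%E.
Proof.
move=> [_ _ posT] Ee; apply: esum_ge; exists [set e].
  by split => [|_ ->//]; exact: finite_set1.
by rewrite fsbig_set1.
Qed.

Lemma trace_cst0 : trace ip (fun=> 0) = 0%E.
Proof. by apply: esum1 => e _; rewrite -/(rip _ _) rip0l. Qed.

(** Cauchy-Schwarz gives [T e = 0] for each basis vector, so by symmetry every [T x] is orthogonal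
    to the whole basis. *)
Lemma psd_basis_eq0 T : psd T ->
  (forall e, get (orthonormal_basis ip) e -> <[T e, e]> = 0) -> T = (fun=> 0).
Proof.
move=> psdT T0; have [linT saT _] := psdT.
apply/funext => x; apply: (basisP ip_norm).2 => e Ee.
rewrite (eq_ip_adjoint linT linT saT) (psd_form_eq0 psdT (T0 _ Ee)).
by rewrite linear0r.
Qed.

Lemma trace_class_lty T : positive_op ip T -> trace_class ip T ->
  (trace ip T < +oo)%E.
Proof. by move=> posT [_]; rewrite op_abs_positive. Qed.

End traces.

(** * Residual operators and their losses of trace *)

Section residual_operators.
Context {R : realType} {H : completeNormedModType R[i]}.
Context (ip : {dot H for (@Num.conj R[i])}) (ip_norm : induces_norm ip).
Context {m : nat} (R0 : H -> H) (R0_pos : positive_op ip R0).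
Context (C : 'I_m -> H -> H) (C_contr : forall j, contraction_op (C j)).

Local Notation rip := (rip ip).
Local Notation psd := (psd ip).
Local Notation "<[ x , y ]>" := (rip x y) (format "<[ x ,  y ]>").
Local Notation residual := (residual ip R0 C).

(** With [S] the root of [T], the new residual is [S (1 - C* C) S] and the loss is [S C* C S];
    contractivity gives [C* C <= 1]. The residual inherits the bound of [T]. *)
Lemma residual_step_positive T j : positive_op ip T ->
  positive_op ip (residual_step ip C T j) /\ psd (T \- residual_step ip C T j).
Proof.
move=> posT; have [/(positive_op_psd ip_norm) psdS SS] := op_sqrtP ip_norm posT.
have [bC C_le] := C_contr j.
have [/(bounded_opP ip_norm)[linA _] adjC] := adjointP ip_norm bC.
have [linC _] := (bounded_opP ip_norm _).1 bC.
rewrite /residual_step; set S := op_sqrt ip T in psdS SS *.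
set A := adjoint ip (C j) in linA adjC *.
have [linS saS posS] := psdS.
have radj x y : <[A (C j x), y]> = <[C j x, C j y]>.
  rewrite ripC [RHS]ripC.
  exact: (congr1 (@complex.Re _) (esym (adjC y (C j x)))).
have psdCC : psd (fun x => A (C j x)).
  split=> [a x y|x y|x]; first by rewrite linC linA.
  - by rewrite radj [RHS]ripC radj ripC.
  - by rewrite radj rip_ge0.
have psdQ : psd (fun x => x - A (C j x)).
  apply: psd_sub (psd_id ip) psdCC _ => x; rewrite radj.
  have := C_le x; rewrite -[leRHS]mul1r -[1]/(real_complex R 1).
  by rewrite (norm_le_rip ip_norm)// expr1n mul1r.
have psdT' := psd_conj psdS psdQ.
have psdD : psd (T \- (S \o (idfun \- (A \o C j)) \o S)).
  have -> : T \- (S \o (idfun \- (A \o C j)) \o S) = fun x => S (A (C j (S x))).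
    by apply/funext => x; rewrite -SS /= (linB linS) subKr.
  exact: (psd_conj psdS psdCC).
split=> //; apply/(positive_opP ip_norm); split=> //.
have [_ [M M0 T_le]] := (positive_opP ip_norm _).1 posT.
exists M => // x; rewrite (le_trans _ (T_le x))// -subr_ge0.
by have [_ _ /(_ x)] := psdD; rewrite /= ripDl ripNl.
Qed.

Lemma residual_rcons w j :
  residual (rcons w j) = residual_step ip C (residual w) j.
Proof. by rewrite /Defs.residual foldl_rcons. Qed.

Lemma residual_positive w : positive_op ip (residual w).
Proof.
elim/last_ind: w => [//|w j IHw]; rewrite residual_rcons.
by have [] := residual_step_positive j IHw.
Qed.

Lemma dissipated_psd w j : psd (dissipated ip R0 C w j).
Proof.
rewrite /dissipated residual_rcons.
by have [] := residual_step_positive j (residual_positive w).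
Qed.

Lemma residual_decr w j x :
  <[residual (rcons w j) x, x]> <= <[residual w x, x]>.
Proof.
rewrite -subr_ge0; have [_ _ /(_ x)] := dissipated_psd w j.
by rewrite /= ripDl ripNl.
Qed.

Lemma trace_residual w j : trace ip (residual w) =
  (trace ip (residual (rcons w j)) + trace_loss ip R0 C w j)%E.
Proof.
rewrite -trace_psd_add.
- by congr trace; apply/funext => x; rewrite /= addrC subrK.
- exact/(positive_op_psd ip_norm)/residual_positive.
- exact: dissipated_psd.
Qed.

Lemma trace_residual_ge0 w : (0 <= trace ip (residual w))%E.
Proof. exact/trace_psd_ge0/(positive_op_psd ip_norm)/residual_positive. Qed.

Lemma trace_loss_ge0 w j : (0 <= trace_loss ip R0 C w j)%E.
Proof. exact/trace_psd_ge0/dissipated_psd. Qed.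

Hypothesis R0_tr : trace_class ip R0.

Lemma trace_residual_fin_num w : trace ip (residual w) \is a fin_num.
Proof.
rewrite ge0_fin_numE ?trace_residual_ge0//.
elim/last_ind: w => [|w j]; first exact: trace_class_lty.
by apply: le_lt_trans; rewrite [leRHS](trace_residual w j) leeDl ?trace_loss_ge0.
Qed.

Lemma trace_loss_fin_num w j : trace_loss ip R0 C w j \is a fin_num.
Proof.
rewrite ge0_fin_numE ?trace_loss_ge0//.
have := trace_residual_fin_num w; rewrite ge0_fin_numE ?trace_residual_ge0//.
by apply: le_lt_trans; rewrite (trace_residual w j) leeDr ?trace_residual_ge0.
Qed.

(** Consequently the walk depends on the operators only through the traces of the residuals. *)
Lemma trace_loss_fineE w j : fine (trace_loss ip R0 C w j) =
  fine (trace ip (residual w)) - fine (trace ip (residual (rcons w j))).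
Proof.
rewrite (trace_residual w j) fineD ?trace_residual_fin_num ?trace_loss_fin_num//.
by rewrite addrC addKr.
Qed.

End residual_operators.

(** * The size-biased walk *)

Section words.
Context {m : nat}.
Implicit Types (u : seq 'I_m.+1) (a : 'I_m.+1).

(** The appended sequence is empty for the letter 0 and a single letter otherwise. *)
Lemma live_prefix_alive u a : ord0 \notin u ->
  live_prefix (rcons u a) = live_prefix u ++ seq_of_opt (unlift ord0 a).
Proof.
move=> u0; rewrite /live_prefix -cats1 index_cat (negbTE u0) (memNindex u0).
rewrite take_size take_cat ltnNge leq_addr/= addnC addnK pmap_cat; congr (_ ++ _).
by case: unliftP => [j ->|->] /=; rewrite ?liftK.
Qed.

Lemma live_prefix_dead u a : ord0 \in u ->
  live_prefix (rcons u a) = live_prefix u.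
Proof.
move=> u0; rewrite /live_prefix -cats1 index_cat u0 take_cat.
by rewrite -index_mem in u0; rewrite u0.
Qed.

(** Growing words on the right matches the recursion of the measure on cylinders. *)
Fixpoint words (n : nat) : seq (seq 'I_m.+1) :=
  if n is n'.+1 then [seq rcons u a | u <- words n', a <- enum 'I_m.+1]
  else [:: [::]].

Lemma words_uniq n : uniq (words n).
Proof.
elim: n => [//|n IHn] /=; apply: allpairs_uniq => //; first exact: enum_uniq.
by move=> [u a] [v b] _ _ /= /rcons_inj.
Qed.

Lemma path_prefixS n (omega : path_space m) :
  path_prefix n.+1 omega = rcons (path_prefix n omega) (omega n).
Proof. exact: mkseqS. Qed.

Lemma path_prefix_words n (omega : path_space m) : path_prefix n omega \in words n.
Proof.
elim: n => [|n IHn]; first by rewrite inE.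
by rewrite path_prefixS /=; apply: allpairs_f => //; rewrite mem_enum.
Qed.

Lemma size_words n u : u \in words n -> size u = n.
Proof.
elim: n u => [|n IHn] u /=; first by rewrite inE => /eqP ->.
by move=> /allpairsP[[v a] [/= /IHn <- _ ->]]; rewrite size_rcons.
Qed.

Lemma big_words (V : nmodType) n (F : seq 'I_m.+1 -> V) :
  \sum_(u <- words n.+1) F u =
  \sum_(u <- words n) (F (rcons u ord0) + \sum_(j < m) F (rcons u (lift ord0 j))).
Proof.
rewrite /= big_allpairs_dep; apply: eq_bigr => u _.
by rewrite big_enum big_ord_recl.
Qed.

(** A cylinder is a finite intersection of preimages of points under continuous projections to
    discrete spaces. *)
Lemma open_cylinder u : open (cylinder u).
Proof.
elim/last_ind: u => [|u a].
  have -> : cylinder [::] = [set: path_space m] by apply/seteqP; split.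
  exact: openT.
have -> : cylinder (rcons u a) =
    cylinder u `&` (proj (size u) @^-1` [set a : discrete_topology 'I_m.+1]).
  rewrite /cylinder size_rcons; apply/seteqP; split=> omega /=.
    by rewrite path_prefixS => /rcons_inj[].
  by move=> [uE aE]; rewrite path_prefixS uE -aE.
move=> open_u; apply: openI => //; apply: open_comp; last exact: discrete_open.
by move=> x _; exact: proj_continuous.
Qed.

Lemma measurable_cylinder u : @measurable _ (borel_path_space m) (cylinder u).
Proof. by apply: sub_sigma_algebra; exact: open_cylinder. Qed.

Lemma measurable_indic_cylinder (R : realType) u :
  measurable_fun [set: borel_path_space m] (\1_(cylinder u) : _ -> R).
Proof. exact: (measurable_indic (measurable_cylinder u)). Qed.

(** This makes functions of the first [n] letters measurable and their integrals finite sums. *)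
Lemma sum_words_cylinder (R : realType) n (F : seq 'I_m.+1 -> R)
    (omega : path_space m) :
  F (path_prefix n omega) =
  \sum_(u <- words n) F u * \1_(cylinder u) omega.
Proof.
rewrite (bigD1_seq (path_prefix n omega)) ?path_prefix_words ?words_uniq//=.
rewrite indicE mem_set ?mulr1; last by rewrite /cylinder/= size_mkseq.
rewrite big_seq_cond big1 ?addr0// => u /andP[/size_words szu neq].
rewrite indicE memNset ?mulr0// /cylinder/= szu => uE.
by move: neq; rewrite uE eqxx.
Qed.

End words.

(** * The walk driven by the losses of an abstract weight on words *)

Section loss_walk.
Context {R : realType} {m : nat} (m_gt0 : (0 < m)%N).
Variables (t : seq 'I_m -> R) (alpha : R).
Hypotheses (t_ge0 : forall w, 0 <= t w) (alpha_gt0 : 0 < alpha).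
Hypothesis t_decr : forall w j, t (rcons w j) <= t w.

Definition loss_sum (w : seq 'I_m) := \sum_(j < m) (t w - t (rcons w j)).

Hypothesis leak : forall w, alpha * t w <= loss_sum w.

(** The counterpart of [trace_prob] with the real weight [t] in place of the trace of the
    residual. *)
Definition loss_prob (u : seq 'I_m.+1) (a : 'I_m.+1) : R :=
  let w := live_prefix u in
  if (ord0 \notin u) && (0 < loss_sum w) then
    if unlift ord0 a is Some j then (t w - t (rcons w j)) / loss_sum w else 0
  else (a == ord0)%:R.

Variable nu : probability (borel_path_space m) R.
Hypothesis nu_nil : nu (cylinder [::]) = 1%E.
Hypothesis nu_rcons : forall u a,
  nu (cylinder (rcons u a)) = (nu (cylinder u) * (loss_prob u a)%:E)%E.

Let q (u : seq 'I_m.+1) : R := fine (nu (cylinder u)).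

Let nuE u : nu (cylinder u) = (q u)%:E.
Proof. by rewrite fineK// fin_num_measure//; exact: measurable_cylinder. Qed.

Let q_ge0 u : 0 <= q u. Proof. exact/fine_ge0/measure_ge0. Qed.

Let q_rcons u a : q (rcons u a) = q u * loss_prob u a.
Proof. by rewrite /q nu_rcons nuE. Qed.

Let t_eq0 w : loss_sum w <= 0 -> t w = 0.
Proof.
move=> /(le_trans (leak w)); rewrite pmulr_rle0// => tw.
by apply/eqP; rewrite eq_le tw t_ge0.
Qed.

(* The letter 0 is drawn only where nothing is left to lose. *)
Let dead_word u : ord0 \in u -> q u * t (live_prefix u) = 0.
Proof.
elim/last_ind: u => [//|u a IHu].
have [u0 _|u0] := boolP (ord0 \in u).
  by rewrite live_prefix_dead// q_rcons mulrAC IHu// mul0r.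
rewrite mem_rcons inE (negbTE u0) orbF => /eqP <-.
rewrite live_prefix_alive// unlift_none cats0 q_rcons /loss_prob u0 unlift_none/=.
by case: ltP => [_|/t_eq0 ->]; rewrite !(mulr0, mul0r).
Qed.

(* Letters are drawn proportionally to the losses [e j], so the mean remaining
   weight is [\sum_j e j / s * (t - e j) = t - (\sum_j e j ^ 2) / s], which is
   at most [t - s / m]. *)
Let one_step u : q (rcons u ord0) * t (live_prefix (rcons u ord0)) +
    \sum_(j < m) q (rcons u (lift ord0 j)) * t (live_prefix (rcons u (lift ord0 j)))
  <= (1 - alpha / m%:R) * (q u * t (live_prefix u)).
Proof.
have [u0|u0] := boolP (ord0 \in u).
  rewrite live_prefix_dead// q_rcons mulrAC dead_word// mul0r mulr0 add0r.
  rewrite big1// => j _.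
  by rewrite live_prefix_dead// q_rcons mulrAC dead_word// mul0r.
set w := live_prefix u.
under eq_bigr do
  rewrite live_prefix_alive// liftK q_rcons /loss_prob u0 liftK /= -/w cats1.
rewrite live_prefix_alive// unlift_none cats0 q_rcons /loss_prob u0 unlift_none.
rewrite -/w /=.
case: ltP => [s_gt0|/t_eq0 ->]; last first.
  by rewrite !mulr0 add0r big1// => j _; rewrite mul0r.
rewrite mulr0 mul0r add0r mulrCA.
under eq_bigr do rewrite -mulrA.
rewrite -mulr_sumr ler_wpM2l//.
pose e j := t w - t (rcons w j).
have -> : \sum_(j < m) e j / loss_sum w * t (rcons w j) =
    t w - (\sum_(j < m) e j ^+ 2) / loss_sum w.
  rewrite (eq_bigr (fun j => (e j * t w - e j ^+ 2) / loss_sum w)); last first.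
    by move=> j _; rewrite /e; field; rewrite gt_eqF.
  rewrite -mulr_suml sumrB -mulr_suml -/(loss_sum w) mulrBl.
  by rewrite mulrAC divff ?gt_eqF// mul1r.
rewrite mulrBl mul1r lerB// ler_pdivlMr//.
apply: le_trans (sum_sqr_ge e m_gt0); rewrite -/(loss_sum w).
(* Leakage bounds one of the two factors [loss_sum w] from below by [alpha * t w]. *)
have -> : alpha / m%:R * t w * loss_sum w =
  alpha * t w * (loss_sum w / m%:R) by ring.
by rewrite expr2 -[leRHS]mulrA ler_wpM2r// divr_ge0// ltW.
Qed.

Let T n (omega : path_space m) : R := t (live_prefix (path_prefix n omega)).

Let measurable_T n :
  measurable_fun [set: borel_path_space m] (fun omega => (T n omega)%:E).
Proof.
have -> : (fun omega => (T n omega)%:E) = fun omega =>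
    (\sum_(u <- words n) t (live_prefix u) * \1_(cylinder u) omega)%:E.
  apply/funext => omega; congr EFin.
  exact: (sum_words_cylinder n (t \o live_prefix)).
apply/measurable_EFinP/measurable_sum => u.
by apply: measurable_funM => //; exact: measurable_indic_cylinder.
Qed.

Let integral_T n : (\int[nu]_omega (T n omega)%:E =
  (\sum_(u <- words n) q u * t (live_prefix u))%:E)%E.
Proof.
transitivity (\int[nu]_omega
    (\sum_(u <- words n) (t (live_prefix u) * \1_(cylinder u) omega)%:E))%E.
  apply: eq_integral => omega _; rewrite sumEFin; congr EFin.
  exact: (sum_words_cylinder n (t \o live_prefix)).
rewrite ge0_integral_sum//.
- rewrite -sumEFin; apply: eq_bigr => u _.
  under eq_integral do rewrite EFinM.
  rewrite ge0_integralZl//.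
  + have -> : (\int[nu]_omega (\1_(cylinder u) omega)%:E = (q u)%:E)%E.
      rewrite -nuE -[in RHS](setIT (cylinder u)).
      exact: (integral_indic nu measurableT (measurable_cylinder u)).
    by rewrite -EFinM mulrC.
  + by apply/measurable_EFinP; exact: measurable_indic_cylinder.
  + by rewrite lee_fin.
- move=> u; apply/measurable_EFinP.
  by apply: measurable_funM => //; exact: measurable_indic_cylinder.
- by move=> u omega _; rewrite lee_fin mulr_ge0.
Qed.

Hypothesis alpha_le : alpha <= m%:R.

Lemma contraction_factor : 0 <= 1 - alpha / m%:R < 1.
Proof.
have m0 : 0 < (m%:R : R) by rewrite ltr0n.
by rewrite subr_ge0 ler_pdivrMr// mul1r alpha_le gtrBl divr_gt0.
Qed.

Lemma expectation_decay n : (\int[nu]_omega (T n omega)%:E <=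
  ((1 - alpha / m%:R) ^+ n * t [::])%:E)%E.
Proof.
have /andP[c0 _] := contraction_factor.
rewrite integral_T lee_fin; elim: n => [|n IHn].
  by rewrite big_seq1 /q nu_nil expr0.
rewrite big_words exprS -mulrA (le_trans _ (ler_wpM2l c0 IHn))// mulr_sumr.
by apply: ler_sum => u _; exact: one_step.
Qed.

Let T_decr omega n : T n.+1 omega <= T n omega.
Proof.
rewrite /T path_prefixS.
have [u0|u0] := boolP (ord0 \in path_prefix n omega).
  by rewrite live_prefix_dead.
rewrite live_prefix_alive//; case: unliftP => [j _|_]; last by rewrite cats0.
by rewrite cats1 t_decr.
Qed.

Lemma walk_cvg0_ae : {ae nu, forall omega : path_space m,
  (T n omega)%:E @[n --> \oo] --> 0%E}.
Proof.
(* The limit along a decreasing path is its infimum, taken in [\bar R]. *)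
pose G (omega : path_space m) := ereal_inf (range (fun n => (T n omega)%:E)).
have cvgG omega : (T n omega)%:E @[n --> \oo] --> G omega.
  apply: ereal_nonincreasing_cvgn; apply/nonincreasing_seqP => n.
  by rewrite lee_fin T_decr.
have G_ge0 omega : (0 <= G omega)%E.
  by apply: le_ereal_inf_tmp => _ [n _ <-]; rewrite lee_fin t_ge0.
have measG : measurable_fun [set: borel_path_space m] G.
  apply: (@emeasurable_fun_cvg _ (borel_path_space m) R setT
    (fun n omega => (T n omega)%:E)) => //.
have intG0 : (\int[nu]_omega `|G omega| = 0)%E.
  under eq_integral do rewrite gee0_abs//.
  apply/eqP; rewrite eq_le integral_ge0// andbT.
  have G_le n : (\int[nu]_omega G omega <= ((1 - alpha / m%:R) ^+ n * t [::])%:E)%E.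
    apply: le_trans (expectation_decay n); apply: ge0_le_integral => //.
    by move=> omega _; apply: ereal_inf_lbound; exists n.
  have cvg0 : ((1 - alpha / m%:R) ^+ n * t [::])%:E @[n --> \oo] --> (0 : \bar R).
    apply: cvg_EFin; first exact: nearW.
    rewrite -(mul0r (t [::])); apply: cvgM; last exact: cvg_cst.
    by apply: cvg_expr; have /andP[c0 c1] := contraction_factor; rewrite ger0_norm.
  by apply: (cvge_to_ge cvg0); exact: nearW.
have G_ae : ae_eq nu setT G (cst 0%E).
  exact: (ae_eq_integral_abs nu measurableT measG).1 intG0.
apply: filterS G_ae => omega /(_ I) G0.
by rewrite -[X in _ --> X]G0.
Qed.

End loss_walk.

Lemma ae_impl d (T : measurableType d) (R : realType) (mu : measure T R)
    (P Q : T -> Prop) : (forall x, P x -> Q x) ->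
  {ae mu, forall x, P x} -> {ae mu, forall x, Q x}.
Proof. by move=> PQ; exact: filterS. Qed.

(** * Decay of the residual traces and vanishing of the limit *)

Theorem theorem5p9 (R : realType) (H : completeNormedModType R[i])
    (ip : {dot H for (@Num.conj R[i])}) (ip_norm : induces_norm ip)
    (m : nat) (m_ge1 : (1 <= m)%N)
    (R0 : H -> H) (R0_pos : positive_op ip R0) (R0_tr : trace_class ip R0)
    (C : 'I_m -> H -> H) (C_contr : forall j, contraction_op (C j))
    (nu : probability (borel_path_space m) R)
    (nu_tr : trace_biased ip R0 C nu)
    (alpha : R) (alpha_gt0 : 0 < alpha) (alpha_le : alpha <= m%:R)
    (leakage : forall w : seq 'I_m,
      (alpha%:E * trace ip (residual ip R0 C w) <= trace_loss_sum ip R0 C w)%E) :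
  let T (n : nat) (omega : path_space m) :=
    trace ip (residual_path ip R0 C n omega) in
  let c := 1 - alpha / m%:R in
  0 <= c < 1 /\
  (forall n : nat,
    (\int[nu]_omega T n omega <= (c ^+ n)%:E * trace ip R0)%E) /\
  {ae nu, forall omega, T n omega @[n --> \oo] --> 0%E} /\
  {ae nu, forall omega, trace ip (residual_limit ip R0 C omega) = 0%E} /\
  {ae nu, forall omega, residual_limit ip R0 C omega = (fun=> 0)}.
Proof.
move=> T c.
pose t w := fine (trace ip (residual ip R0 C w)).
have tE w : trace ip (residual ip R0 C w) = (t w)%:E.
  by rewrite fineK// trace_residual_fin_num.
have lossE w j : fine (trace_loss ip R0 C w j) = t w - t (rcons w j).
  exact: trace_loss_fineE.
have loss_sumE w : trace_loss_sum ip R0 C w = (loss_sum t w)%:E.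
  rewrite /trace_loss_sum /loss_sum -sumEFin; apply: eq_bigr => j _.
  by rewrite -lossE fineK// trace_loss_fin_num.
have t_ge0 w : 0 <= t w by rewrite fine_ge0// trace_residual_ge0.
have t_decr w j : t (rcons w j) <= t w.
  by rewrite -subr_ge0 -lossE fine_ge0// trace_loss_ge0.
have leak w : alpha * t w <= loss_sum t w.
  by rewrite -lee_fin EFinM -tE -loss_sumE.
(* This identifies [nu] as the law of the abstract walk with weight [t]. *)
have probE u a : trace_prob ip R0 C u a = loss_prob t u a.
  rewrite /trace_prob /loss_prob loss_sumE lte_fin /=.
  by case: unlift => // j; rewrite lossE.
have [nu_nil nu_rcons] := nu_tr.
have nu_rcons' u a :
    nu (cylinder (rcons u a)) = (nu (cylinder u) * (loss_prob t u a)%:E)%E.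
  by rewrite nu_rcons probE.
have TE n omega : T n omega = (t (live_prefix (path_prefix n omega)))%:E.
  exact: tE.
have T_ae : {ae nu, forall omega, T n omega @[n --> \oo] --> 0%E}.
  have t_ae :=
    walk_cvg0_ae m_ge1 t_ge0 alpha_gt0 t_decr leak nu_nil nu_rcons' alpha_le.
  by apply: (ae_impl _ t_ae) => omega; under eq_fun do rewrite -TE.
have limit_ae : {ae nu, forall omega, residual_limit ip R0 C omega = (fun=> 0)}.
  apply: (ae_impl _ T_ae) => omega T0.
  pose S n := residual_path ip R0 C n omega.
  have posS n : positive_op ip (S n) by exact: residual_positive.
  have psdS n : psd ip (S n) by exact/(positive_op_psd ip_norm).
  have [_ [M M0 S0_le]] := (positive_opP ip_norm _).1 (posS 0).
  (* From the first 0 on the residual is constant; before it, each letter lowers the form. *)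
  have S_decr n x : rip ip (S n.+1 x) x <= rip ip (S n x) x.
    rewrite /S /residual_path /residual0 path_prefixS.
    have [u0|u0] := boolP (ord0 \in path_prefix n omega).
      by rewrite live_prefix_dead.
    rewrite live_prefix_alive//; case: unliftP => [j _|_]; last by rewrite cats0.
    by rewrite cats1 residual_decr.
  apply: (psd_basis_eq0 ip_norm).
    exact: (strong_lim_psd ip_norm psdS M0 S0_le S_decr).
  move=> e Ee; apply/eqP; rewrite eq_le; apply/andP; split; last first.
    by have [_ _] := strong_lim_psd ip_norm psdS M0 S0_le S_decr; exact.
  (* For every [n], [<L e, e> <= <R_n e, e> <= tr R_n], and the right side tends to [0]. *)
  rewrite -lee_fin; apply: (cvge_to_ge T0); apply: nearW => n.
  apply: le_trans (form_le_trace (psdS n) Ee).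
  by rewrite lee_fin (strong_lim_form_le ip_norm psdS M0 S0_le S_decr).
split; first exact: contraction_factor.
split=> [n|].
  rewrite -[R0]/(residual ip R0 C [::]) tE -EFinM.
  under eq_integral do rewrite TE.
  exact: expectation_decay.
split=> //; split=> //.
(* The zero trace of the limit is deduced from the limit being zero, not conversely. *)
by apply: (ae_impl _ limit_ae) => omega ->; exact: trace_cst0.
Qed.
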